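(* Let $(a, d, \psi)$ be a Pythagorean triple, i.e. positive integers with $a^2 + d^2 = \psi^2$, so that $a$ is one of its legs and $\psi$ its hypotenuse. Put $b = 2a\psi$ and $c = a^3$. Then the quadratic equation $$a x^2 + b x + c = 0$$ has two real solutions, and both of them are integers.
   Context: A Pythagorean triple consists of positive integers $(a,d,\psi)$ with $a^2+d^2=\psi^2$; $a$ and $d$ are called its legs (either leg may play the role of $a$) and $\psi$ its hypotenuse. *)

(* Defs.v *)
From Stdlib Require Import Reals ZArith.

Definition pythagorean_triple (a d psi : Z) : Prop :=
  (0 < a /\ 0 < d /\ 0 < psi /\ a ^ 2 + d ^ 2 = psi ^ 2)%Z.

Definition quadratic_root (a b c x : R) : Prop :=
  (a * x ^ 2 + b * x + c = 0)%R.

Definition is_integer (x : R) : Prop := exists n : Z, x = IZR n.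

(* Main.v *)
Require Import Defs.
From Stdlib Require Import Reals ZArith.
From Stdlib Require Import Lra.

(** Since [a ^ 2 = psi ^ 2 - d ^ 2], completing the square turns the quadratic
    into [a * ((x + psi) ^ 2 - d ^ 2)]: the other leg [d] is the square root of
    the reduced discriminant [psi ^ 2 - a ^ 2]. The roots are therefore
    [- psi + d] and [- psi - d]: they are integers, and distinct as [d > 0]. *)

Lemma quadratic_factors (a d psi x : R) :
  (a ^ 2 + d ^ 2 = psi ^ 2)%R ->
  (a * x ^ 2 + 2 * a * psi * x + a ^ 3
   = a * ((x - (- psi + d)) * (x - (- psi - d))))%R.
Proof.
  intros Hpyth.
  replace (a ^ 3)%R with (a * (psi ^ 2 - d ^ 2))%R by (rewrite <- Hpyth; ring).
  ring.
Qed.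

Theorem mainTheorem1 (a d psi b c : Z)
  (htriple : pythagorean_triple a d psi)
  (hb : b = (2 * a * psi)%Z)
  (hc : c = (a ^ 3)%Z) :
  exists x1 x2 : R,
    x1 <> x2 /\
    (forall x : R,
        quadratic_root (IZR a) (IZR b) (IZR c) x <-> x = x1 \/ x = x2) /\
    is_integer x1 /\ is_integer x2.
Proof.
  destruct htriple as (Ha & Hd & _ & Hpyth); subst b c.
  apply IZR_lt in Ha; apply IZR_lt in Hd.
  apply (f_equal IZR) in Hpyth.
  rewrite plus_IZR, <- !(pow_IZR _ 2) in Hpyth.
  exists (- IZR psi + IZR d)%R, (- IZR psi - IZR d)%R.
  split; [lra | split; [| split]].
  - intros x; unfold quadratic_root.
    rewrite !mult_IZR, <- (pow_IZR _ 3), (quadratic_factors _ _ _ x Hpyth).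
    split.
    + intros H.
      apply Rmult_integral in H; destruct H as [H | H]; [lra |].
      apply Rmult_integral in H; destruct H as [H | H]; [left | right]; lra.
    + intros [-> | ->]; ring.
  - exists (- psi + d)%Z; now rewrite plus_IZR, opp_IZR.
  - exists (- psi - d)%Z; now rewrite minus_IZR, opp_IZR.
Qed.
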